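(* Let $p$ be a prime, let $n \ge 1$, let $G = \bigoplus_{i=1}^{n} Z(p^{i})$, and let $S_{n}$ be the symmetric group on $\{1,\dots,n\}$. Then \[ \# (X(G) / {\sim}) = \sum_{k=1}^{n-1} k \cdot k! \cdot \left( (k+1)^{n-k} - k^{n-k} \right) = \sum_{\sigma \in S_{n}} \max_{1 \leq i \leq n} \{ \sigma(i) - i \}. \]
   Context: $Z(p^{r}) = \mathbb{Z}/p^{r}\mathbb{Z}$. For a finite abelian group $G$, $X(G)$ is the set of cyclic subgroups $H$ of $G$ for which there exists $f \in \operatorname{Hom}(H,G)$ such that $F|_H \ne f$ for every $F \in \operatorname{End}(G)$. For $x \in Z(p^r)$, $v_p(x)$ is the largest non-negative integer $k$ such that $x = m p^k$ for some integer $m$ not divisible by $p$ if $x\neq 0$, and $v_p(0)=r$. For cyclic subgroups $H=\langle (h_1,\dots,h_n)\rangle$ and $H'=\langle (h'_1,\dots,h'_n)\rangle$ of $G=\bigoplus_{i=1}^n Z(p^{i})$, define $H\sim H'$ if and only if $v_p(h_i)=v_p(h'_i)$ for all $i$; this does not depend on the choice of generators and is an equivalence relation. $X(G)/{\sim}$ is the set of equivalence classes of $\sim$ on $X(G)$, and $\#$ denotes cardinality. *)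

(* Defs.v *)
From mathcomp Require Import all_boot all_order all_algebra.
From mathcomp Require Import all_fingroup all_solvable.

Set Implicit Arguments.
Unset Strict Implicit.
Unset Printing Implicit Defensive.

Import Order.TTheory GRing.Theory Num.Theory.

Local Open Scope nat_scope.

(* A homomorphism H -> gT is a function on gT that is multiplicative on H; its
   values outside H are never used. *)
Definition nonextendable (gT : finGroupType) (H : {group gT}) : bool :=
  [exists f : {ffun gT -> gT}, morphic H f &&
    [forall F : {ffun gT -> gT},
       morphic [set: gT] F ==> [exists x in H, F x != f x]]].

Definition X (gT : finGroupType) : {set {group gT}} :=
  [set H : {group gT} | cyclic H && nonextendable H].

(* The index i ranges over 0, ..., n-1, so the summands are Z/p, ..., Z/p^n.
   The group law of this product is coordinatewise addition, written
   multiplicatively. *)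
Definition G (p n : nat) : finGroupType := {dffun forall i : 'I_n, 'Z_(p ^ i.+1)}.

Definition vp (p r : nat) (x : 'Z_(p ^ r)) : nat :=
  if x == 0%R then r else logn p x.

(* logn is applied to the representative of x in [0, p^r); for x <> 0 this is
   the only k such that x = m p^k with m prime to p. *)
Lemma vpE (p r : nat) (x : 'Z_(p ^ r)) (k : nat) :
  prime p -> 0 < r -> x != 0%R ->
  (k = vp x) <-> (exists2 m : nat, ~~ (p %| m) & x = ((m * p ^ k)%:R)%R).
Proof.
move=> pp r0 x0; rewrite /vp (negbTE x0).
have pr1 : 1 < p ^ r by rewrite -(expn0 p) ltn_exp2l ?prime_gt1.
have xgt0 : 0 < x by rewrite lt0n.
split=> [->|[m pm xE]].
  have [m cpm mE] := pfactor_coprime pp xgt0.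
  exists m; first by rewrite -prime_coprime.
  by rewrite -mE natr_Zp.
have xv : x = (m * p ^ k) %% p ^ r :> nat by rewrite xE val_Zp_nat.
have ltkr : k < r.
  rewrite ltnNge; apply/negP => lerk; move: xgt0.
  by rewrite xv (eqP (dvdn_mull m (dvdn_exp2l p lerk))).
have m0 : 0 < m by case: (m) pm; rewrite ?dvdn0.
have dvdE j : j <= r -> (p ^ j %| x) = (p ^ j %| m * p ^ k).
  move=> lejr; rewrite (divn_eq (m * p ^ k) (p ^ r)) -xv dvdn_addr //.
  by rewrite dvdn_mull // dvdn_exp2l.
apply/eqP; rewrite eqn_leq -(pfactor_dvdn _ pp xgt0) dvdE ?(ltnW ltkr) //.
rewrite dvdn_mull //= leqNgt -(pfactor_dvdn _ pp xgt0) dvdE //.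
by rewrite expnS dvdn_pmul2r ?expn_gt0 ?prime_gt0.
Qed.

Definition sim (p n : nat) (H H' : {group G p n}) : bool :=
  [exists h : G p n, exists h' : G p n,
     [&& H == <[h]>%g :> {set G p n}, H' == <[h']>%g :> {set G p n} &
         [forall i : 'I_n, vp (h i) == vp (h' i)]]].

Definition Xclasses (p n : nat) : {set {set {group G p n}}} :=
  equivalence_partition (@sim p n) (X (G p n)).

Local Open Scope ring_scope.

Definition displacement (n : nat) (s : 'S_n) (i : 'I_n) : int :=
  (s i)%:Z - (nat_of_ord i)%:Z.

(* The maximum over a nonempty index set, seeded with one of its own terms. *)
Definition max_displacement (n : nat) (n_gt0 : (0 < n)%N) (s : 'S_n) : int :=
  \big[Num.max/displacement s (Ordinal n_gt0)]_(i < n) displacement s i.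

(* Main.v *)
Require Import Defs.
From mathcomp Require Import all_boot all_order all_algebra all_fingroup all_solvable.
From mathcomp Require Import zify ring.

(** Write [b_i] for the exponent of the order of the [i]-th coordinate of a
    generator [h] of [H], so that [#[h i] = p ^ b_i].  Since
    [b_i = i.+1 - vp (h i)], two cyclic subgroups are related by [sim] exactly
    when they have the same tuple [b] (lemma [simE]), and every tuple with
    [b_i <= i.+1] occurs.

    Whether [H] lies in [X] can be read off [b].  Let [k.+1] be the largest
    entry of [b], so that [H] has order [p ^ k.+1]; the summand of index [k] is
    then [Z/p^(k+1)].  (If all entries vanish, [H] is trivial and every morphism
    on it extends.)
    - If [b_k = k.+1], the coordinate [h k] generates that summand, and any
      [f : H -> G] extends to [x |-> f h ^+ (x k / h k)], the exponent being
      taken modulo [p ^ k.+1].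
    - If [b_k <= k], every coordinate of [h] of order [p ^ k.+1] sits in a
      summand of larger order, hence is a [p]-th power.  Therefore
      [h ^+ (p ^ k)] is of the form [y ^+ (p ^ k.+1)], and any endomorphism
      sends it to an element whose [k]-th coordinate vanishes.  The morphism
      mapping [h] to the canonical generator of the [k]-th summand violates
      this, so it does not extend.

    So the classes in [X] are the tuples with largest entry [k.+1] and
    [b_k <= k] for some [k].  For each [k] they form the difference of two boxes
    of tuples, whose cardinals are products; this gives the [k]-th term of the
    sum.

    On the side of permutations, [max (s i - i)] is the number of [k < n] such
    that the displacement of [s] exceeds [k] somewhere, and the permutations
    with displacements at most [k] number [N k = k! * (k+1)^(n-k)]
    ([card_perm_displacement_le]).  The sum of the maxima is thus
    [\sum_(k < n) (n! - N k)], and summation by parts turns it into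
    [\sum_k k * (N k - N k.-1)], which is the sum over [k] again. *)

Set Implicit Arguments.
Unset Strict Implicit.
Unset Printing Implicit Defensive.

Import Order.TTheory GRing.Theory Num.Theory.

Local Open Scope nat_scope.

(** * Permutations of bounded displacement *)

Lemma card_ord_le (n k : nat) : (k < n)%N -> #|[pred j : 'I_n | j <= k]%N| = k.+1.
Proof.
move=> ltkn; rewrite -[RHS]card_ord -!sum1_card (big_ord_widen n (fun=> 1%N) ltkn).
by apply: eq_bigl => j; rewrite inE ltnS.
Qed.

(** A permutation amounts to the image of [j0] together with the permutation
    induced between the complements of [j0] and of its image. *)
Lemma card_lift_perm (n : nat) (j0 : 'I_n.+1) (P : pred 'S_n.+1) :
  #|[pred s | P s]| = #|[pred t : 'I_n.+1 * 'S_n | P (lift_perm j0 t.1 t.2)]|.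
Proof.
have injf : injective (fun t : 'I_n.+1 * 'S_n => lift_perm j0 t.1 t.2).
  move=> [j s] [j' s'] /= eq_js.
  have eq_j : j = j' by rewrite -(lift_perm_id j0 j s) eq_js lift_perm_id.
  rewrite -{}eq_j in eq_js *; congr (_, _); apply/permP => i.
  by apply: (@lift_inj _ j); rewrite -!(lift_perm_lift j0) eq_js.
rewrite -(card_image injf).
apply/esym/eq_card => s.
have [|g _ fK] := inj_card_bij injf.
  by rewrite card_prod card_ord !card_Sn factS.
apply/imageP/idP => [[t Pt ->] | Ps]; first exact: Pt.
by exists (g s); rewrite ?inE ?fK.
Qed.

(** Induction on [n] by deleting the first point: its image [j] has [k.+1]
    possible values, and closing the gap left by [j] does not affect the bound,
    since only values above [j] are shifted while those below [j <= k] satisfy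
    the bound anyway.  The induction starts at [n = k], where the bound holds
    for all permutations. *)
Lemma card_perm_displacement_le (n k : nat) : (k <= n)%N ->
  #|[pred s : 'S_n | [forall i, s i <= i + k]%N]| = (k`! * k.+1 ^ (n - k))%N.
Proof.
elim: n => [|n IHn] lekn.
  have -> : k = 0%N by lia.
  rewrite muln1 -[RHS](card_Sn 0); apply: eq_card => s.
  by rewrite !inE; apply/forallP; case.
have [->|neq_kn] := eqVneq k n.+1.
  rewrite subnn muln1 -card_Sn; apply: eq_card => s; rewrite !inE.
  by apply/forallP => i; apply: ltnW; apply: ltn_addl; apply: ltn_ord.
have {}lekn : (k <= n)%N by lia.
rewrite subSn // expnS mulnCA -IHn //.
apply: etrans (card_lift_perm ord0 (fun s => [forall i, s i <= i + k]%N)) _.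
rewrite -(@card_ord_le n.+1 k) // -cardX.
apply: eq_card => -[j s]; rewrite !inE /=.
apply/forallP/andP => [bound|[lejk /forallP bound] i].
  have lejk : (j <= k)%N by have := bound ord0; rewrite lift_perm_id.
  split=> //; apply/forallP => i; have := bound (lift ord0 i).
  rewrite lift_perm_lift /= /bump; lia.
case: (unliftP ord0 i) => [i' ->|->]; last by rewrite lift_perm_id.
have := bound i'; rewrite lift_perm_lift /= /bump; lia.
Qed.

Lemma sum_ord_gt (n d : nat) : (d <= n)%N -> (\sum_(k < n) (k < d) = d)%N.
Proof.
move=> ledn; rewrite -[RHS](card_ord d) -sum1_card.
rewrite (big_ord_widen n (fun=> 1%N) ledn).
by rewrite [RHS]big_mkcond; apply: eq_bigr => i _; case: ifP.
Qed.

Local Open Scope ring_scope.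

(** The layer-cake formula: the maximum is nonnegative because the point [0]
    cannot move down, so it is the number of levels [k] that it exceeds. *)
Lemma max_displacement_count (n : nat) (n_gt0 : (0 < n)%N) (s : 'S_n) :
  max_displacement n_gt0 s =
  (\sum_(k < n) ~~ [forall i, s i <= i + k]%N)%N%:Z.
Proof.
have leP x : (max_displacement n_gt0 s <= x)
           = [forall i, displacement s i <= x].
  apply/idP/forallP => [lex i|lex].
    apply: le_trans lex.
    exact: (@le_bigmax_cond _ _ _ _ _ xpredT (displacement s)).
  by apply/bigmax_leP; split.
have : 0 <= max_displacement n_gt0 s.
  apply: (@le_trans _ _ (displacement s (Ordinal n_gt0))).
    by rewrite /displacement /=; lia.
  exact: (@le_bigmax_cond _ _ _ _ _ xpredT (displacement s)).
have : max_displacement n_gt0 s <= n.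
  rewrite leP; apply/forallP => i; rewrite /displacement.
  have := ltn_ord (s i); lia.
move: leP; case: (max_displacement n_gt0 s) => // d leP ledn _.
congr Posz; rewrite -[LHS](@sum_ord_gt n) //.
apply: eq_bigr => k _; rewrite ltnNge; congr (nat_of_bool (~~ _)).
have := leP k; rewrite lez_nat => ->.
by apply: eq_forallb => i; rewrite /displacement; lia.
Qed.

Lemma sum_by_parts (N : nat -> int) (m : nat) :
  \sum_(k < m) (N m - N k) = \sum_(1 <= k < m.+1) k%:Z * (N k - N k.-1).
Proof.
elim: m => [|m IHm]; first by rewrite big_ord0 big_geq.
rewrite big_nat_recr //= -IHm big_ord_recr /=.
have -> : \sum_(i < m) (N m.+1 - N i) =
          \sum_(i < m) (N m - N i) + m%:Z * (N m.+1 - N m).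
  rewrite -[m%:Z]natz mulr_natl -[X in _ *+ X](card_ord m) -sumr_const.
  rewrite -big_split /=.
  by apply: eq_bigr => i _; ring.
rewrite -[m.+1%:Z]natz -natr1 natz; ring.
Qed.

Lemma sum_max_displacement (n : nat) (n_gt0 : (0 < n)%N) :
  \sum_(s : 'S_n) max_displacement n_gt0 s =
  \sum_(1 <= k < n)
    k%:Z * (k`!)%:Z * ((k.+1)%:Z ^+ (n - k) - k%:Z ^+ (n - k)).
Proof.
pose N k : int := (k`!)%:Z * (k.+1)%:Z ^+ (n - k).
transitivity (\sum_(k < n) ((n`!)%:Z - N k)).
  under eq_bigr do rewrite max_displacement_count -natz natr_sum.
  rewrite exchange_big; apply: eq_bigr => k _ /=.
  have -> : N k = \sum_(s : 'S_n) ([forall i, s i <= i + k]%N)%:R.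
    rewrite -natr_sum -big_mkcond sum1_card natz.
    rewrite card_perm_displacement_le 1?ltnW // PoszM.
    by rewrite -[(_ ^ _)%:Z]natz natrX natz.
  rewrite -card_Sn -sum1_card -[(\sum_(i in _) _)%:Z]natz natr_sum -sumrB.
  by apply: eq_big => [s|s _]; rewrite ?inE //; case: [forall _, _].
case: n n_gt0 @N => // m _ N.
(* The level k = m contributes nothing, since N m = n! counts all permutations. *)
rewrite big_ord_recr /=.
have Nm : N m = (m.+1`!)%:Z by rewrite /N subSnn expr1 factS mulnC PoszM.
rewrite Nm subrr addr0 -Nm sum_by_parts.
apply: eq_big_nat => k /andP[k_gt0 lekm]; rewrite -mulrA; congr (_ * _).
rewrite /N mulrBr prednK // -subSS.
case: k k_gt0 lekm => // k _ lekm /=.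
have -> : (m.+1 - k = (m.+2 - k.+2).+1)%N by lia.
by rewrite exprS subSS factS PoszM; ring.
Qed.

Local Close Scope ring_scope.
Local Open Scope group_scope.

(** * Orders in cyclic p-groups *)

Lemma Zp1_expg (m : nat) (x : 'Z_m) : (Zp1 : 'Z_m) ^+ x = x.
Proof. by apply: val_inj; rewrite Zp_expg /= modnMml mul1n modn_small. Qed.

Lemma order_Zp_gcd (m : nat) (x : 'Z_m) : 1 < m -> #[x] = m %/ gcdn m x.
Proof.
case: m x => [|[|m]] // x _.
by rewrite -[in LHS](Zp1_expg x) orderXgcd order_Zp1.
Qed.

Lemma pexp_gt1 (p r : nat) : prime p -> 1 < p ^ r.+1.
Proof. by move=> p_pr; rewrite -(expn0 p) ltn_exp2l ?prime_gt1. Qed.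

Lemma vp_le (p r : nat) (x : 'Z_(p ^ r.+1)) : prime p -> vp x <= r.+1.
Proof.
move=> p_pr; rewrite /vp; case: eqP => // /eqP x_neq0.
have x_gt0 : 0 < x by rewrite lt0n.
rewrite -(leq_exp2l _ _ (prime_gt1 p_pr)).
apply: leq_trans (dvdn_leq x_gt0 (pfactor_dvdnn p x)) _.
by rewrite -[leqRHS](Zp_cast (pexp_gt1 r p_pr)) ltnW.
Qed.

Lemma order_Zp_pexp (p r : nat) (x : 'Z_(p ^ r.+1)) :
  prime p -> #[x] = (p ^ (r.+1 - vp x))%N.
Proof.
move=> p_pr; have p_gt0 := prime_gt0 p_pr.
have le_vr := vp_le x p_pr.
have [->|x_neq0] := eqVneq x 1; first by rewrite order1 /vp eqxx subnn.
have vpx : vp x = logn p x by rewrite /vp ifN.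
have x_gt0 : 0 < x by rewrite lt0n.
have [m cpm mE] := pfactor_coprime p_pr x_gt0.
rewrite order_Zp_gcd ?pexp_gt1 // mE -vpx mulnC Gauss_gcdl ?coprimeXl //.
by rewrite gcdnC (gcdn_idPl (dvdn_exp2l p le_vr)) expnB.
Qed.

(** An element whose representative is prime to [p] generates the group, so the
    representative of [x] is a multiple of [p]. *)
Lemma Zp_pexp_root (p r : nat) (x : 'Z_(p ^ r.+1)) :
  prime p -> #[x] < p ^ r.+1 -> exists y, x = y ^+ p.
Proof.
move=> p_pr; rewrite order_Zp_gcd ?pexp_gt1 // => ltx.
have p_dvd_x : p %| x.
  apply: contraLR ltx; rewrite -prime_coprime // => cpx.
  by rewrite -leqNgt (eqP (coprimeXl r.+1 cpx)) divn1.
by exists (Zp1 ^+ (x %/ p)); rewrite -expgM divnK // Zp1_expg.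
Qed.

(** * Extension of homomorphisms from a cyclic subgroup *)

Definition log_order (p n : nat) (h : G p n) (i : 'I_n) : nat := logn p #[h i].

Lemma order_coord (p n : nat) (h : G p n) (i : 'I_n) :
  prime p -> #[h i] = (p ^ log_order h i)%N.
Proof. by move=> p_pr; rewrite /log_order order_Zp_pexp // pfactorK. Qed.

Lemma log_orderE (p n : nat) (h : G p n) (i : 'I_n) :
  prime p -> log_order h i = (i.+1 - vp (h i))%N.
Proof. by move=> p_pr; rewrite /log_order order_Zp_pexp // pfactorK. Qed.

Lemma log_order_le (p n : nat) (h : G p n) (i : 'I_n) :
  prime p -> log_order h i <= i.+1.
Proof. by move=> p_pr; rewrite log_orderE // leq_subr. Qed.

Lemma dffunX (p n : nat) (x : G p n) (e : nat) (i : 'I_n) :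
  (x ^+ e) i = x i ^+ e.
Proof. exact: (morphX (dffun_morphism _ i) e (in_setT x)). Qed.

Lemma log_order_leE (p n : nat) (h : G p n) (i : 'I_n) (m : nat) :
  prime p -> (log_order h i <= m) = (h i ^+ (p ^ m) == 1).
Proof.
by move=> p_pr; rewrite -order_dvdn order_coord // dvdn_Pexp2l ?prime_gt1.
Qed.

(** The obstruction is a divisibility: [h ^+ (p ^ k)] is a [p ^ k.+1]-th power
    in [G], whereas its image under the morphism mapping [h] to the generator of
    the [k]-th summand is not. *)
Lemma nonextendable_of_pivot (p n : nat) (h : G p n) (k : 'I_n) :
    prime p -> (forall i, log_order h i <= k.+1) -> log_order h k <= k ->
    (exists i, k < log_order h i) ->
  nonextendable <[h]>.
Proof.
move=> p_pr hmax hk [i0 ltki0].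
pose g : G p n := dfung1 (Zp1 : 'Z_(p ^ k.+1)).
have oZp1 : #[Zp1 : 'Z_(p ^ k.+1)] = (p ^ k.+1)%N.
  by rewrite order_Zp1 Zp_cast ?pexp_gt1.
have dvd_gh : #[g] %| #[h].
  apply: (@dvdn_trans (p ^ k.+1)%N).
    have Zp1X : (Zp1 : 'Z_(p ^ k.+1)) ^+ (p ^ k.+1) = 1.
      by apply/eqP; rewrite -order_dvdn oZp1.
    rewrite order_dvdn -(morphX (dfung1_morphism _ k)) ?inE //= Zp1X.
    by rewrite (morph1 (dfung1_morphism _ k)).
  apply: (@dvdn_trans #[h i0]).
    by rewrite order_coord // dvdn_exp2l.
  by rewrite order_dvdn -dffunX expg_order ffunE.
apply/existsP; exists [ffun x => eltm dvd_gh x]; apply/andP; split.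
  apply/morphicP => x y hx hy; rewrite !ffunE.
  exact: (morphM (eltm_morphism dvd_gh)).
apply/forallP => F; apply/implyP => /morphicP F_morph.
apply/exists_inP; exists h; first exact: cycle_id.
rewrite ffunE eltm_id; apply/eqP => Fh.
have root i : exists y, h i ^+ (p ^ k) = y ^+ (p ^ k.+1).
  have [lehk|gthk] := leqP (log_order h i) k.
    by exists 1; rewrite expg1n; apply/eqP; rewrite -log_order_leE.
  (* Here i > k, so that h i, of order p ^ k.+1, does not generate Z/p^(i+1). *)
  have neq_ik : i != k by apply: contraTneq gthk => ->; rewrite -leqNgt.
  have hi := log_order_le h i p_pr.
  have [|y ->] := @Zp_pexp_root p i (h i) p_pr.
    have := hmax i; rewrite order_coord // ltn_exp2l ?prime_gt1 //.
    by move: neq_ik; rewrite -val_eqE /=; lia.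
  by exists y; rewrite -expgM -expnS.
have [y0 y0P] := fin_all_exists root.
pose y : G p n := finfun y0.
have hy : h ^+ (p ^ k) = y ^+ (p ^ k.+1).
  by apply/ffunP => i; rewrite !dffunX y0P ffunE.
pose Fm := Morphism F_morph.
have FX x e : F (x ^+ e) = F x ^+ e by apply: (morphX Fm); rewrite inE.
have := congr1 (fun z : G p n => z k) (congr1 F hy).
rewrite !FX Fh !dffunX dfung1_id => gk.
have : p ^ k.+1 %| p ^ k.
  rewrite -[X in X %| _]oZp1 order_dvdn gk -order_dvdn.
  by rewrite order_Zp_pexp // dvdn_exp2l // leq_subr.
by rewrite dvdn_Pexp2l ?prime_gt1 // ltnn.
Qed.

(** The hypotheses make the [k]-th projection an isomorphism from [<[h]>] onto
    the [k]-th summand.  So [<[h]>] is a direct factor of [G], with the kernel of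
    that projection as a complement, and a morphism extends by composing it with
    the projection onto [<[h]>]. *)
Lemma extendable_of_coord (p n : nat) (h : G p n) (k : 'I_n) :
    prime p -> (forall i, log_order h i <= k.+1) -> log_order h k = k.+1 ->
  ~~ nonextendable <[h]>.
Proof.
move=> p_pr hmax hk.
rewrite negb_exists; apply/forallP => f; apply/nandP.
case: (boolP (morphic _ f)) => [/morphicP f_morph|]; [right | by left].
rewrite negb_forall; apply/existsP.
pose fm := Morphism f_morph.
have fX e : f (h ^+ e) = f h ^+ e by apply: (morphX fm); apply: cycle_id.
have fh1 : f h ^+ (p ^ k.+1) = 1.
  rewrite -fX; have -> : h ^+ (p ^ k.+1) = 1.
    by apply/ffunP => i; rewrite dffunX ffunE; apply/eqP; rewrite -log_order_leE.
  exact: (morph1 fm).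
have [c hc] : exists c, h k ^+ c = Zp1.
  have : Zp1 \in <[h k]>.
    have -> : <[h k]> = [set: 'Z_(p ^ k.+1)]; last by rewrite inE.
    apply/eqP; rewrite eqEcard subsetT /= -/(#[h k]) order_coord // hk.
    by rewrite cardsT card_ord Zp_cast ?pexp_gt1.
  by case/cycleP => c ->; exists c.
(* Since c inverts h k modulo p ^ k.+1, the power z ^+ x k is f h ^+ (x k / h k). *)
pose z := f h ^+ c.
have zX : z ^+ (Zp_trunc (p ^ k.+1)).+2 = 1.
  by rewrite Zp_cast ?pexp_gt1 // -expgM mulnC expgM fh1 expg1n.
pose F : {ffun G p n -> G p n} := [ffun x : G p n => z ^+ x k].
have F_morph : {in [set: G p n] &, {morph F : x y / x * y}}.
  by move=> x y _ _; rewrite !ffunE -expgD; apply: (expg_mod _ zX).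
have Fh : F h = f h.
  have fhX : f h ^+ (Zp_trunc (p ^ k.+1)).+2 = 1 by rewrite Zp_cast ?pexp_gt1.
  rewrite ffunE -expgM -(expg_mod _ fhX) mulnC.
  have -> : (h k * c %% (Zp_trunc (p ^ k.+1)).+2)%N = 1%N.
    by have := congr1 val hc; rewrite Zp_expg.
  by rewrite expg1.
exists F; rewrite negb_imply; apply/andP; split; first exact/morphicP.
rewrite negb_exists_in; apply/forall_inP => _ /cycleP[e ->]; rewrite negbK.
by rewrite fX -Fh; apply/eqP; apply: (morphX (Morphism F_morph)); rewrite inE.
Qed.

Lemma trivial_extendable (gT : finGroupType) : ~~ nonextendable [1 gT].
Proof.
rewrite negb_exists; apply/forallP => f; apply/nandP.
case: (boolP (morphic _ f)) => [/morphicP f_morph|]; [right | by left].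
rewrite negb_forall; apply/existsP; exists [ffun=> 1].
rewrite negb_imply; apply/andP; split.
  by apply/morphicP => x y _ _; rewrite !ffunE mulg1.
rewrite negb_exists_in; apply/forall_inP => x /set1P ->.
have f1 : f 1 = 1 := morph1 (Morphism f_morph).
by rewrite negbK ffunE f1.
Qed.

(** For [k.+1] the largest exponent, the lemmas above settle the two cases
    [log_order h k <= k] and [log_order h k = k.+1]; all exponents vanish only
    for the trivial subgroup. *)
Lemma nonextendableP (p n : nat) (h : G p n) : prime p ->
  reflect (exists k : 'I_n, [/\ forall i, log_order h i <= k.+1,
             exists i, k < log_order h i & log_order h k <= k])
    (nonextendable <[h]>).
Proof.
move=> p_pr; apply: (iffP idP) => [|[k [hmax hi hk]]]; last first.
  exact: nonextendable_of_pivot hi.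
have [h0|/existsP[i1 hi1]] := boolP [forall i, log_order h i == 0].
  suff -> : <[h]>%G = 1%G by rewrite (negPf (trivial_extendable _)).
  apply: val_inj => /=; suff -> : h = 1 by rewrite cycle1.
  apply/ffunP => i; rewrite ffunE; apply/eqP.
  rewrite -[h i]expg1 -(expn0 p) -log_order_leE //.
  by rewrite (eqP (forallP h0 i)).
case: (@arg_maxnP _ i1 xpredT (log_order h)) => // i0 _ i0max.
case hk: (log_order h i0) => [|k].
  by have := i0max i1 isT; rewrite /= hk leqn0 (negPf hi1).
have ltkn : k < n by have := log_order_le h i0 p_pr; have := ltn_ord i0; lia.
have kmax i : log_order h i <= (Ordinal ltkn).+1 by rewrite /= -hk; apply: i0max.
have [lek|gtk] := leqP (log_order h (Ordinal ltkn)) k => h_nonext.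
  by exists (Ordinal ltkn); split=> //; exists i0; rewrite hk.
suff /negP : ~~ nonextendable <[h]> by [].
apply: (@extendable_of_coord _ _ _ (Ordinal ltkn)) => //.
by apply/anti_leq; rewrite kmax.
Qed.

(** * The invariant of a class *)

(** The tuple of exponents of the coordinates, expressed through the projections
    of [H] so that no generator has to be chosen. *)
Definition profile (p n : nat) (H : {group G p n}) : {ffun 'I_n -> 'I_n.+1} :=
  [ffun i => inord (logn p #|dffun_morphism _ i @* H|)].

Lemma profile_cycle (p n : nat) (h : G p n) (i : 'I_n) : prime p ->
  profile <[h]> i = log_order h i :> nat.
Proof.
move=> p_pr; rewrite ffunE morphim_cycle ?inE //= -/(#[h i]) -/(log_order h i).
by rewrite inordK // ltnS (leq_trans (log_order_le h i p_pr)).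
Qed.

(** Valuation and exponent of the order of the [i]-th coordinate add up to
    [i.+1], so they carry the same information. *)
Lemma simE (p n : nat) (H H' : {group G p n}) : prime p ->
  cyclic H -> cyclic H' -> sim H H' = (profile H == profile H').
Proof.
move=> p_pr /cyclicP[h defH] /cyclicP[h' defH'].
have {}defH : H = <[h]>%G by apply: val_inj.
have {}defH' : H' = <[h']>%G by apply: val_inj.
rewrite defH defH'; apply/existsP/eqP => [[g /existsP[g']]|eq_prof].
  move=> /and3P[/eqP Hg /eqP Hg' /forallP eq_vp].
  rewrite (val_inj Hg : _ = <[g]>%G) (val_inj Hg' : _ = <[g']>%G).
  apply/ffunP => i; apply: ord_inj; rewrite !profile_cycle // !log_orderE //.
  by rewrite (eqP (eq_vp i)).
exists h; apply/existsP; exists h'; rewrite !eqxx /=; apply/forallP => i.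
have := congr1 (fun b : {ffun 'I_n -> 'I_n.+1} => b i : nat) eq_prof.
rewrite /= !profile_cycle // !log_orderE // => eq_vp.
by rewrite -(subKn (vp_le (h i) p_pr)) eq_vp subKn ?vp_le.
Qed.

Lemma card_equivalence_partition_image (T rT : finType) (R : rel T)
    (f : T -> rT) (D : {set T}) :
    {in D &, forall x y, R x y = (f x == f y)} ->
  #|equivalence_partition R D| = #|f @: D|.
Proof.
move=> Rf; pose fiber t := [set y in D | t == f y].
have -> : equivalence_partition R D = fiber @: (f @: D).
  rewrite -imset_comp; apply: eq_in_imset => x Dx; apply/setP => y.
  by rewrite !inE; case: (boolP (y \in D)) => // Dy; rewrite Rf.
rewrite card_in_imset // => _ t' /imsetP[x Dx ->] _ /setP/(_ x).
by rewrite !inE Dx eqxx => /esym/eqP.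
Qed.

(** * Counting the tuples *)

Definition box (n : nat) (c : 'I_n -> nat) : {set {ffun 'I_n -> 'I_n.+1}} :=
  [set b : {ffun 'I_n -> 'I_n.+1} | [forall i, b i <= c i]].

(** Being outside the second box forces some entry to equal [k.+1], so these are
    the tuples of profiles with largest entry [k.+1] and a smaller [k]-th entry.
    The difference of boxes is what makes them easy to count. *)
Definition pivot_box (n : nat) (k : 'I_n) :=
  box (fun i : 'I_n => if i == k then k : nat else minn i.+1 k.+1)
  :\: box (fun i : 'I_n => minn i.+1 k).

Lemma pivot_boxP (n : nat) (k : 'I_n) (b : {ffun 'I_n -> 'I_n.+1}) :
  reflect [/\ forall i, b i <= i.+1, forall i, b i <= k.+1,
              exists i, k < b i & b k <= k]
    (b \in pivot_box k).
Proof.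
rewrite !inE; apply: (iffP andP) => [[/forallPn[i gti] /forallP le_b]|].
  have lei j : b j <= j.+1 /\ b j <= k.+1.
    by have := le_b j; case: eqP => [->|_] ?; lia.
  split=> [j|j||]; [by case: (lei j) | by case: (lei j) | | ].
    by exists i; have [] := lei i; lia.
  by have := le_b k; rewrite eqxx.
move=> [le_i le_k [i lt_i] bk]; split.
  by apply/forallPn; exists i; have := le_i i; lia.
apply/forallP => j; have := le_i j; have := le_k j.
by case: eqP => [->|_] //; lia.
Qed.

(** Every tuple in a [pivot_box] is realized: the element of [Z/p^(j+1)]
    represented by [p ^ (j.+1 - b j)] has order [p ^ b j]. *)
Lemma profile_X (p n : nat) : prime p ->
  [set profile H | H in X (G p n)] = \bigcup_(k < n) pivot_box k.
Proof.
move=> p_pr; apply/setP => b; apply/imsetP/bigcupP => [[H]|[k _]].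
  rewrite inE => /andP[/cyclicP[h defH]].
  have {}defH : H = <[h]>%G by apply: val_inj.
  rewrite {H}defH => /(nonextendableP _ p_pr)[k [hmax [i hi] hk]] ->.
  exists k => //; apply/pivot_boxP; split=> [j|j||]; rewrite ?profile_cycle //.
    exact: log_order_le.
  by exists i; rewrite profile_cycle.
move=> /pivot_boxP[le_i le_k [i lt_i] bk].
pose h : G p n :=
  finfun (fun i : 'I_n => (Zp1 : 'Z_(p ^ i.+1)) ^+ (p ^ (i.+1 - b i))).
have hb j : log_order h j = b j.
  have dvd_j : p ^ (j.+1 - b j) %| #[Zp1 : 'Z_(p ^ j.+1)].
    by rewrite order_Zp1 Zp_cast ?pexp_gt1 // dvdn_exp2l // leq_subr.
  rewrite /log_order ffunE orderXdiv // order_Zp1 Zp_cast ?pexp_gt1 //.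
  by rewrite -expnB ?prime_gt0 ?leq_subr // pfactorK // subKn.
exists <[h]>%G; last by apply/ffunP => j; apply: ord_inj; rewrite !profile_cycle.
rewrite inE cycle_cyclic; apply/(nonextendableP _ p_pr).
exists k; split=> [j||]; rewrite ?hb //.
by exists i; rewrite hb.
Qed.

Local Close Scope group_scope.

Lemma card_box (n : nat) (c : 'I_n -> nat) : (forall i, c i <= n) ->
  #|box c| = \prod_(i < n) (c i).+1.
Proof.
move=> le_cn.
have -> : #|box c| = #|family (fun i : 'I_n => [pred j : 'I_n.+1 | j <= c i])|.
  by apply: eq_card => b; rewrite !inE.
rewrite card_family foldrE big_map big_enum /=.
by apply: eq_bigr => i _; rewrite card_ord_le // ltnS.
Qed.

Lemma prod_minn (n m : nat) : m <= n ->
  \prod_(i < n) (minn i.+1 m).+1 = (m.+1`! * m.+1 ^ (n - m))%N.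
Proof.
elim: n m => [|n IHn] m lemn; first by rewrite big_ord0 (_ : m = 0) //; lia.
rewrite big_ord_recr /=; have [->|neq_mn] := eqVneq m n.+1.
  have -> : \prod_(i < n) (minn i.+1 n.+1).+1 = \prod_(i < n) (minn i.+1 n).+1.
    by apply: eq_bigr => i _; have := ltn_ord i; lia.
  by rewrite IHn // minnn !subnn !muln1 mulnC [in RHS]factS.
have {}lemn : m <= n by lia.
rewrite IHn // (minn_idPr _) 1?leqW // subSn // expnS -mulnA.
by congr muln; rewrite mulnC.
Qed.

(** The cardinal of the second box is an instance of [prod_minn], and so is that
    of the first one but for its factor of index [k], which is [k.+1] instead of
    [k.+2]. *)
Lemma card_pivot_box (n : nat) (k : 'I_n) :
  #|pivot_box k| =
  (k.+1 * k.+1`! * (k.+2 ^ (n - k.+1) - k.+1 ^ (n - k.+1)))%N.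
Proof.
have ltkn := ltn_ord k.
rewrite cardsD (setIidPr _); last first.
  apply/subsetP => b; rewrite !inE => /forallP le_b; apply/forallP => i.
  by have := le_b i; case: eqP => [->|_]; lia.
have le_v (i : 'I_n) : minn i.+1 k <= n by lia.
have le_w (i : 'I_n) : (if i == k then k : nat else minn i.+1 k.+1) <= n.
  by case: ifP; lia.
rewrite (card_box le_v) (card_box le_w).
rewrite prod_minn ?(ltnW ltkn) //.
have := prod_minn ltkn; rewrite (bigD1 k) //= minnn => prod_k.
rewrite (bigD1 k) //= eqxx.
under eq_bigr => i /negPf neq_ik do rewrite neq_ik.
set P := (\prod_(i < n | _) _)%N in prod_k *.
have -> : P = (k.+1`! * k.+2 ^ (n - k.+1))%N.
  by apply/eqP; rewrite -(eqn_pmul2l (ltn0Sn k.+1)) prod_k factS mulnA.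
have -> : n - k = (n - k.+1).+1 by lia.
by rewrite expnS mulnBr; congr subn; rewrite mulnA // [k.+1`! * _]mulnC.
Qed.

(** A tuple determines [k], as its largest entry is [k.+1]. *)
Lemma disjoint_pivot_box (n : nat) (k l : 'I_n) :
  k != l -> [disjoint pivot_box k & pivot_box l].
Proof.
rewrite -val_eqE => neq_kl; apply/pred0P => b /=; apply/andP.
case=> /pivot_boxP[_ le_k [i lti] _] /pivot_boxP[_ le_l [j ltj] _].
have := le_k j; have := le_l i; move: neq_kl => /=; lia.
Qed.

Lemma card_Xclasses (p n : nat) : prime p ->
  #|Xclasses p n| =
  \sum_(1 <= k < n) k * k`! * (k.+1 ^ (n - k) - k ^ (n - k)).
Proof.
move=> p_pr.
rewrite (@card_equivalence_partition_image _ _ _ (@profile p n)); last first.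
  by move=> H H'; rewrite !inE => /andP[cH _] /andP[cH' _]; apply: simE.
rewrite profile_X // -sum1_card partition_disjoint_bigcup; last first.
  exact: disjoint_pivot_box.
under eq_bigr do rewrite sum1_card card_pivot_box.
rewrite -(big_mkord xpredT
  (fun k => k.+1 * k.+1`! * (k.+2 ^ (n - k.+1) - k.+1 ^ (n - k.+1)))).
(* The last term, absent on the right, vanishes: both powers have exponent 0. *)
case: n => [|n]; first by rewrite !big_geq.
by rewrite big_nat_recr //= subnn subnn muln0 addn0 [RHS]big_add1.
Qed.

Local Open Scope ring_scope.

Theorem proposition4p1 (p n : nat) (p_prime : prime p) (n_gt0 : (0 < n)%N) :
  let S : int :=
    \sum_(1 <= k < n)
      k%:Z * (k`!)%:Z * ((k.+1)%:Z ^+ (n - k) - k%:Z ^+ (n - k)) in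
  (#|Xclasses p n|)%:Z = S /\
  S = \sum_(s : 'S_n) max_displacement n_gt0 s.
Proof.
move=> S; split; last by rewrite sum_max_displacement.
rewrite card_Xclasses // -[LHS]natz natr_sum; apply: eq_bigr => k _.
have le_exp : (k ^ (n - k) <= k.+1 ^ (n - k))%N.
  by case: (n - k)%N => // e; rewrite leq_exp2r.
by rewrite !natrM natrB // !natrX !natz.
Qed.
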